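(* Let $n\ge1$ be an integer and let $G$ be a finite simple graph with $p\ge1$ vertices and $q$ edges; write $q=tp+t_0$ with $t$ a nonnegative integer and $0\le t_0\le p-1$. Then $\mathcal{D}_n[G]$ is max-$\kappa$ if and only if $G$ is max-$\kappa$ and either $0\le t_0<\frac{p}{2n}$ or $\frac{p}{2}\le t_0<\frac{p(n+1)}{2n}$.
   Context: For an integer $n\ge1$, the total graph $T_n$ is the complete graph $K_n$ with a loop added at every vertex. $\mathcal{D}_n[G]=G\times T_n$ is the Kronecker product: vertex set $V(G)\times\{0,\dots,n-1\}$, with $(u,i)$ adjacent to $(v,j)$ iff $uv\in E(G)$. For a graph $H$ with $p(H)\ge1$ vertices and $q(H)$ edges, $H$ is called max-$\kappa$ if $\kappa(H)=\lfloor 2q(H)/p(H)\rfloor$, where $\kappa$ is vertex-connectivity. *)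

(* Defs.v *)
From mathcomp Require Import all_boot.

Set Implicit Arguments.
Unset Strict Implicit.
Unset Printing Implicit Defensive.

Record sgraph := SGraph {
  vertex :> finType;
  adj : rel vertex;
  adj_sym : symmetric adj;
  adj_irrefl : irreflexive adj
}.

Definition edges (G : sgraph) : {set {set G}} :=
  [set A | [exists x, exists y, adj x y && (A == [set x; y])]].

(* T_n carries loops, so it is a bare relation rather than an sgraph. *)
Definition complete_rel (n : nat) : rel 'I_n := fun i j => i != j.

Definition total_rel (n : nat) : rel 'I_n :=
  fun i j => complete_rel i j || (i == j).

Definition kronecker_rel (U V : finType) (e : rel U) (f : rel V) :
  rel (U * V)%type := fun x y => e x.1 y.1 && f x.2 y.2.

Section Dgraph.
Variables (n : nat) (G : sgraph).

Let Drel := kronecker_rel (@adj G) (@total_rel n).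

Fact Dgraph_sym : symmetric Drel.
Proof.
move=> x y; rewrite /Drel /kronecker_rel /total_rel /complete_rel.
by rewrite adj_sym ![y.2 == _]eq_sym.
Qed.

Fact Dgraph_irrefl : irreflexive Drel.
Proof. by move=> x; rewrite /Drel /kronecker_rel adj_irrefl. Qed.

Definition Dgraph : sgraph := SGraph Dgraph_sym Dgraph_irrefl.

End Dgraph.

Section RemoveVertices.
Variables (G : sgraph) (S : {set G}).

Let remaining : finType := {x : G | x \notin S}.
Let rem_rel : rel remaining := fun x y => adj (val x) (val y).

Fact remove_vertices_sym : symmetric rem_rel.
Proof. by move=> x y; exact: adj_sym. Qed.

Fact remove_vertices_irrefl : irreflexive rem_rel.
Proof. by move=> x; exact: adj_irrefl. Qed.

Definition remove_vertices : sgraph :=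
  SGraph remove_vertices_sym remove_vertices_irrefl.

End RemoveVertices.

Definition connected (G : sgraph) : bool :=
  [forall x : G, forall y : G, connect (@adj G) x y].

(* Deleting S leaves a disconnected graph or a graph with at most one vertex,
   so that the connectivity of the complete graph K_p is p - 1. *)
Definition vertex_cut (G : sgraph) (S : {set G}) : bool :=
  ~~ connected (remove_vertices S) || (#|remove_vertices S| <= 1).

Lemma vertex_cutT (G : sgraph) : vertex_cut [set: G].
Proof.
apply/orP; right; rewrite [X in X <= _]eq_card0 // => -[x xS].
by have := xS; rewrite inE.
Qed.

(* The default [set: G] satisfies vertex_cut (vertex_cutT), so this is
   the minimum cardinality of a vertex cut. *)
Definition kappa (G : sgraph) : nat :=
  #|[arg min_(S < [set: G] | vertex_cut S) #|S| ]|.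

Definition max_kappa (G : sgraph) : Prop :=
  kappa G = (2 * #|edges G|) %/ #|G|.

(* Main.v *)
Require Import Defs.
From mathcomp Require Import all_boot all_order all_algebra.
From mathcomp Require Import zify.
Import Order.TTheory GRing.Theory Num.Theory.

(** Each vertex of [G] becomes [n] twins in [D_n[G]].  A cut of [D_n[G]] can
    only be effective through the fibres it contains entirely, whence
    [kappa (D_n[G]) = n * kappa G]; and [D_n[G]] has [n^2 q] edges on [n p]
    vertices.  The theorem thus compares [floor (2nq/p)] with
    [n * floor (2q/p)]. *)

Lemma kappa_le (G : sgraph) (S : {set G}) : vertex_cut S -> kappa G <= #|S|.
Proof.
rewrite /kappa; case: arg_minnP; first exact: vertex_cutT.
by move=> A _ minA /minA.
Qed.

Lemma kappa_attained (G : sgraph) :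
  exists2 S : {set G}, vertex_cut S & kappa G = #|S|.
Proof.
rewrite /kappa; case: arg_minnP; first exact: vertex_cutT.
by move=> A cutA _; exists A.
Qed.

(** Double counting: [pr] sends an arc to its underlying edge, and every edge has exactly two
    preimages. *)
Lemma double_card_edges (G : sgraph) :
  2 * #|edges G| = #|[set z : G * G | adj z.1 z.2]|.
Proof.
pose pr (z : G * G) := [set z.1; z.2].
rewrite -[RHS]sum1_card (partition_big pr (mem (edges G))) /=; last first.
  move=> [x y]; rewrite !inE /= => xy.
  by apply/existsP; exists x; apply/existsP; exists y; rewrite xy eqxx.
rewrite mulnC -sum_nat_const; apply: eq_bigr => A.
rewrite inE => /existsP[x /existsP[y /andP[xy /eqP ->]]].
have neq_xy : x != y by apply: contraTneq xy => ->; rewrite adj_irrefl.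
rewrite sum1dep_card.
(* The two orientations are distinct because there are no loops. *)
have -> : 2 = #|[set (x, y); (y, x)]|.
  by rewrite cards2 xpair_eqE negb_and neq_xy.
apply: eq_card => -[a b]; rewrite !inE /pr /= !xpair_eqE.
apply/orP/andP => [[] /andP[/eqP-> /eqP->] | [ab /eqP/setP eq_ab]].
- by rewrite xy eqxx.
- by rewrite adj_sym xy setUC eqxx.
have neq_ab : a != b by apply: contraTneq ab => ->; rewrite adj_irrefl.
move: (eq_ab a) (eq_ab b) neq_ab neq_xy; rewrite !inE !eqxx orbT /=.
move=> /esym/orP[]/eqP-> /esym/orP[]/eqP->; rewrite ?eqxx //; by [left | right].
Qed.

Lemma total_relT (n : nat) (i j : 'I_n) : total_rel i j.
Proof. by rewrite /total_rel /complete_rel orNb. Qed.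

Lemma adj_Dgraph (n : nat) (G : sgraph) (x y : Dgraph n G) :
  adj x y = adj x.1 y.1.
Proof. by rewrite /= /kronecker_rel total_relT andbT. Qed.

Lemma card_Dgraph (n : nat) (G : sgraph) : #|Dgraph n G| = n * #|G|.
Proof. by rewrite card_prod card_ord mulnC. Qed.

Lemma card_edges_Dgraph (n : nat) (G : sgraph) :
  2 * #|edges (Dgraph n G)| = n * n * (2 * #|edges G|).
Proof.
rewrite !double_card_edges.
(* [f] regroups a pair of vertices as a pair in [G] and a pair of indices; arcs become all of (arcs
   of [G]) x (index pairs). *)
pose f (z : (G * 'I_n) * (G * 'I_n)) := ((z.1.1, z.2.1), (z.1.2, z.2.2)).
have f_inj : injective f by move=> [[? ?] [? ?]] [[? ?] [? ?]] [-> -> -> ->].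
rewrite -(card_imset _ f_inj).
have -> : n * n = #|[set: 'I_n * 'I_n]| by rewrite cardsT card_prod card_ord.
rewrite mulnC -cardsX; apply: eq_card => -[[u v] [i j]].
rewrite in_setX in_setT inE andbT; apply/imsetP/idP => [[[x y]] | uv].
  by rewrite inE adj_Dgraph /= => xy [-> -> _ _].
by exists ((u, i), (v, j)); rewrite // inE adj_Dgraph.
Qed.

Lemma connect_neighbour (T : finType) (e : rel T) (x y : T) :
  connect e x y -> x != y -> exists z, e x z.
Proof.
move=> /connectP[[|z s]] /=; first by move=> _ ->; rewrite eqxx.
by move=> /andP[xz _] _ _; exists z.
Qed.

Section Connectivity.
Variables (n : nat) (G : sgraph).
Hypothesis n_gt0 : 0 < n.

Definition full_fibres (S : {set Dgraph n G}) : {set G} :=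
  [set u | [forall i, (u, i) \in S]].

Lemma card_full_fibres (S : {set Dgraph n G}) : n * #|full_fibres S| <= #|S|.
Proof.
have -> : n * #|full_fibres S| = #|setX (full_fibres S) [set: 'I_n]|.
  by rewrite cardsX cardsT card_ord mulnC.
apply/subset_leq_card/subsetP => -[u i].
by rewrite !inE andbT => /forallP.
Qed.

(** By contraposition: every fibre over [H] keeps a survivor in [K], and adjacency depends only on
    first coordinates, so walks of [H] lift to [K]. *)
Lemma vertex_cut_full_fibres (S : {set Dgraph n G}) :
  vertex_cut S -> vertex_cut (full_fibres S).
Proof.
apply: contraLR; rewrite /vertex_cut !negb_or !negbK -!ltnNge.
set H := remove_vertices (full_fibres S); set K := remove_vertices S.
move=> /andP[/forallP connH H_gt1].
have lift (u : H) : exists x : K, (val x).1 = val u.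
  have := valP u; rewrite inE negb_forall => /existsP[i uiS].
  by exists (Sub (val u, i) uiS).
have projP (x : K) : (val x).1 \notin full_fibres S.
  rewrite inE; apply: contra (valP x) => /forallP /(_ (val x).2).
  by rewrite -surjective_pairing.
pose proj (x : K) : H := Sub (val x).1 (projP x).
have adjK (x y : K) : adj x y = adj (proj x) (proj y).
  by rewrite -[LHS]/(adj (val x) (val y)) adj_Dgraph.
have projS (u : H) : exists x, proj x = u.
  by have [x xu] := lift u; exists x; apply: val_inj.
(* [H] is connected with at least two vertices, hence has no isolated vertex. *)
have nbr (u : H) : exists v, adj u v.
  have /card_gt1P[v [w [_ _ vw]]] := H_gt1.
  have [z uz] : exists z, z != u.
    by case: (eqVneq v u) vw => [-> uw|vu _]; [exists w; rewrite eq_sym|exists v].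
  rewrite eq_sym in uz.
  exact: (connect_neighbour _ _ _ _ (forallP (connH u) z) uz).
have connK (s : seq H) (x y : K) :
    path (@adj H) (proj x) s -> proj y = last (proj x) s ->
    connect (@adj K) x y.
  elim: s x => [|u s IHs] x.
    (* Here [x] and [y] are twins, hence not adjacent; they are joined through a survivor [z] over a
       neighbour of their fibre. *)
    move=> _ eq_yx; have [v xv] := nbr (proj x); have [z zv] := projS v.
    apply: (@connect_trans _ _ z); apply: connect1; rewrite adjK zv //.
    by rewrite eq_yx adj_sym.
  have [z <-] := projS u; case/andP=> xz zs eq_y.
  by apply: connect_trans (IHs z zs eq_y); apply: connect1; rewrite adjK.
apply/andP; split.
  apply/forallP => x; apply/forallP => y.
  have /connectP[s xs eq_y] := forallP (connH (proj x)) (proj y).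
  exact: connK xs eq_y.
have /card_gt1P[v [w [_ _ vw]]] := H_gt1.
have [x xv] := projS v; have [y yw] := projS w.
apply/card_gt1P; exists x, y; split=> //.
by apply: contraNneq vw => eq_xy; rewrite -xv -yw eq_xy.
Qed.

(** Walks of [K] project to walks of [H], so a disconnected [H] forces a disconnected [K]. *)
Lemma vertex_cut_setX (S : {set G}) :
  vertex_cut S -> @vertex_cut (Dgraph n G) (setX S [set: 'I_n]).
Proof.
rewrite /vertex_cut; set S' := setX _ _.
set H := remove_vertices S; set K := remove_vertices (G := Dgraph n G) S'.
have projP (x : K) : (val x).1 \notin S.
  by case: x => -[u i] /= uS'; move: (uS'); rewrite in_setX inE andbT.
pose proj (x : K) : H := Sub (val x).1 (projP x).
have adjK (x y : K) : adj x y = adj (proj x) (proj y).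
  by rewrite -[LHS]/(adj (val x) (val y)) adj_Dgraph.
have projS (u : H) : exists x, proj x = u.
  pose i := Ordinal n_gt0.
  have uS' : (val u, i) \notin S' by rewrite in_setX inE andbT (valP u).
  by exists (Sub (val u, i) uS'); apply: val_inj.
have connP (x y : K) : connect (@adj K) x y -> connect (@adj H) (proj x) (proj y).
  case/connectP => s; elim: s x => [|z s IHs] x; first by move=> _ ->.
  case/andP; rewrite adjK => xz zs eq_y.
  by apply: connect_trans (IHs z zs eq_y); apply: connect1.
case/orP => [disc|H_le1].
  apply/orP; left; apply: contra disc => /forallP connK.
  apply/forallP => u; apply/forallP => v.
  have [x <-] := projS u; have [y <-] := projS v.
  exact/connP/(forallP (connK x)).
(* If [H] has at most one vertex, [K] lies in a single fibre and has no edges: with two or more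
   vertices it is disconnected. *)
case: (leqP #|K| 1) => [_|K_gt1]; first by rewrite orbT.
rewrite orbF; have /card_gt1P[x [y [_ _ xy]]] := K_gt1.
apply: contra xy => /forallP /(_ x) /forallP /(_ y) conn_xy.
apply/negPn/negP => xy; have [z] := connect_neighbour _ _ _ _ conn_xy xy.
have proj_eq : proj x = proj z by exact: (card_le1_eqP H_le1).
by rewrite adjK proj_eq adj_irrefl.
Qed.

Lemma kappa_Dgraph : kappa (Dgraph n G) = n * kappa G.
Proof.
apply/eqP; rewrite eqn_leq; apply/andP; split.
  have [S cutS ->] := kappa_attained G.
  apply: leq_trans (kappa_le _ _ (vertex_cut_setX _ cutS)) _.
  by rewrite cardsX cardsT card_ord mulnC.
have [S cutS ->] := kappa_attained (Dgraph n G).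
apply: leq_trans (card_full_fibres S); rewrite leq_mul2l.
by rewrite kappa_le ?orbT //; apply: vertex_cut_full_fibres.
Qed.

End Connectivity.

Lemma eq_divn_iff (d m k : nat) :
  0 < d -> k = m %/ d <-> k * d <= m < k.+1 * d.
Proof.
move=> d_gt0; split=> [->|/andP[le_km lt_mk]].
  by rewrite leq_trunc_div ltn_ceil.
by apply/eqP; rewrite eqn_leq leq_divRL // le_km -ltnS ltn_divLR.
Qed.

Lemma ltr_natr_div (a b c : nat) : 0 < c ->
  ((a%:R : rat) < b%:R / c%:R)%R = (a * c < b).
Proof. by move=> c_gt0; rewrite ltr_pdivlMr ?ltr0n // -natrM ltr_nat. Qed.

Lemma ler_div_natr (a b c : nat) : 0 < c ->
  (b%:R / c%:R <= (a%:R : rat))%R = (b <= a * c).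
Proof. by move=> c_gt0; rewrite ler_pdivrMr ?ltr0n // -natrM ler_nat. Qed.

Theorem theorem2p4 (n : nat) (G : sgraph) (p q t t0 : nat) :
  1 <= n ->
  #|G| = p -> 1 <= p ->
  #|edges G| = q ->
  q = t * p + t0 -> t0 <= p - 1 ->
  max_kappa (Dgraph n G) <->
  max_kappa G /\
  ((0 <= (t0%:R : rat) < p%:R / (2 * n%:R))%R \/
   (p%:R / 2 <= (t0%:R : rat) < (p%:R * (n%:R + 1)) / (2 * n%:R))%R).
Proof.
move=> n_gt0 cardG p_gt0 cardE def_q t0_le.
rewrite ler0n /= [(_ + 1)%R]natr1 -!natrM.
rewrite !ltr_natr_div ?ler_div_natr ?muln_gt0 //.
rewrite /max_kappa kappa_Dgraph // card_edges_Dgraph card_Dgraph cardG cardE.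
rewrite -mulnA divnMl // !eq_divn_iff // mulnS.
set k := kappa G.
(* Since 2q = 2tp + 2t0 with 2t0 < 2p, the floor of 2q/p is 2t or 2t + 1, according to whether 2t0 <
   p. *)
have kE : k * p <= 2 * q < k.+1 * p ->
    k = 2 * t /\ 2 * t0 < p \/ k = (2 * t).+1 /\ p <= 2 * t0.
  move=> /andP[lo hi].
  have k_lt : k < (2 * t).+2 by rewrite -(ltn_pmul2r p_gt0); lia.
  have k_ge : 2 * t < k.+1 by rewrite -(ltn_pmul2r p_gt0); lia.
  have [k_eq | k_eq] : k = 2 * t \/ k = (2 * t).+1 by lia.
    by left; rewrite k_eq in hi; split=> //; lia.
  by right; rewrite k_eq in lo; split=> //; lia.
split=> [/andP[lo hi] | [/kE k_cases t0_cases]].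
  (* Divide nkp <= 2nq < (nk + 1)p <= n(k + 1)p by n. *)
  have kP : k * p <= 2 * q < k.+1 * p.
    rewrite -(leq_pmul2l n_gt0) mulnA lo -(ltn_pmul2l n_gt0).
    by apply: leq_trans hi _; rewrite mulnA leq_mul2r mulnS; lia.
  (* The bound 2nq < (nk + 1)p reads 2n t0 < p when k = 2t, and 2n t0 < p + pn when k = 2t + 1. *)
  split=> //; have [[k_eq _] | [k_eq t0_ge]] := kE kP; [left | right].
    by rewrite k_eq in hi; subst q; nia.
  by rewrite k_eq in hi; subst q; nia.
have t0E : t0 * (2 * n) = n * (2 * t0) by lia.
(* The mixed cases are contradictory: 2t0 < p excludes the second range of [t0], and p <= 2t0
   excludes the first as n >= 1. *)
case: k_cases => -[-> t0_cmp]; subst q; nia.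
Qed.
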